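(* Consider the class of finite walks on $\mathbb{Z}$ starting at $0$ and with each step advancing by $+1$, $0$ or $-1$. For a walk $w$ in this class that ends at $e\in\{0,1\}$ and whose minimal number visited is $-d$ (so $d\ge 0$), let $\Phi(w)$ be the walk obtained from $w$ by reversing the direction of (i.e. changing into $+1$ steps) the $d$ down-steps of $w$ that first reach respectively the numbers $-1,-2,\dots,-d$. Then $\Phi$ is a bijection from the set of walks in the class that end either at $0$ or at $1$ to the set of walks in the class that do not visit negative numbers. This bijection conserves both the length of the walk and the number of steps $0$, and it maps walks ending at $e\in\{0,1\}$ whose minimal number visited is $-d$ to walks ending at $2d+e$.
   Context: A walk of length $n$ on $\mathbb{Z}$ starting at $0$ with steps in $\{+1,0,-1\}$ is given by a sequence of steps $(s_1,\dots,s_n)\in\{-1,0,1\}^n$; the numbers it visits are $p_0=0$ and $p_k=s_1+\cdots+s_k$ for $1\le k\le n$, and it ends at $p_n$. A down-step is a step $-1$; reversing its direction means replacing it by $+1$. The down-step that first reaches $-j$ (for $1\le j\le d$) is the step $s_k$ where $k$ is the smallest index with $p_k=-j$ (positions are those of the original walk $w$). All walks (of all finite lengths $n\ge 0$) are considered. *)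

(* Defs.v *)
From HB Require Import structures.
From mathcomp Require Import all_boot all_order all_algebra.
From mathcomp Require Import classical_sets functions.

Set Implicit Arguments.
Unset Strict Implicit.
Unset Printing Implicit Defensive.

Import Order.TTheory GRing.Theory Num.Theory.

Local Open Scope ring_scope.

(* A walk s_1, ..., s_n starting at 0 is encoded by its sequence of steps, so
   that s_k is the entry w`_k.-1. *)
Definition is_walk (w : seq int) : bool :=
  all (fun s : int => s \in [:: 1; 0; -1]) w.

Definition pos (w : seq int) (k : nat) : int := \sum_(i < k) w`_i.

(* The list p_0, p_1, ..., p_n of all positions, with repetitions. *)
Definition visited (w : seq int) : seq int :=
  [seq pos w k | k <- iota 0 (size w).+1].

Definition walk_end (w : seq int) : int := pos w (size w).

(* The default value 0 of the iterated minimum is p_0, which is visited. *)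
Definition min_visited (w : seq int) : int :=
  \big[Num.min/0]_(x <- visited w) x.

(* The smallest k with p_k = - j, for a visited - j. *)
Definition first_reach (w : seq int) (j : nat) : nat :=
  index (- j%:Z) (visited w).

(* The indices k in {1, ..., n} of the steps s_k that first reach -1, ..., -d,
   where -d is the minimal number visited. *)
Definition reversed_steps (w : seq int) : seq nat :=
  [seq first_reach w j | j <- iota 1 `|min_visited w|%N].

(* The entry of index i is the step s_(i+1). Since a walk starts at 0 and moves
   by at most 1, the steps listed in reversed_steps are all equal to -1. *)
Definition Phi (w : seq int) : seq int :=
  mkseq (fun i => if i.+1 \in reversed_steps w then 1 else w`_i) (size w).

Definition walks_to_0_or_1 : set (seq int) :=
  [set w | is_walk w /\ (walk_end w = 0 \/ walk_end w = 1)]%classic.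

Definition nonnegative_walks : set (seq int) :=
  [set w | is_walk w /\ (forall x, x \in visited w -> 0 <= x)]%classic.

(* Main.v *)
Require Import Defs.
From HB Require Import structures.
From mathcomp Require Import all_boot all_order all_algebra.
From mathcomp Require Import classical_sets functions.
From mathcomp Require Import zify.

Import Order.TTheory GRing.Theory Num.Theory.

Local Open Scope ring_scope.

(** Read a walk from left to right, keeping track of its position [p] and of
    its running minimum [m <= 0].  A step is reversed exactly when it makes the
    walk drop below [m]; it then replaces [p] by [p - 1] and [m] by [m - 1],
    while the image advances by 1.  Any other step is copied and leaves [m]
    unchanged.  In both cases the position [q] of the image satisfies
    [q = p - 2 m] at all times ([walk_end_Phi]).  As [m <= p] and [m <= 0], the
    image is never negative, and a walk with minimum [- d] that ends at [e] is
    sent to a walk that ends at [2 d + e].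

    Conversely, if the final [m] is known then the image [v] can be decoded
    from right to left.  In the state [q, m] one has [p = q + 2 m].  The last
    step of [v] comes from a reversed step if and only if it is [+1] and
    [p = m], because a copied step [+1] starts at or above the minimum, so it
    ends strictly above it.  This determines the last step of [w] and the
    previous value of [m].  Hence for each nonnegative walk [v] ending at [q],
    and each [m] with [- q <= m <= 0], there is exactly one walk with minimum
    [m] that is sent to [v] ([Phi_min_inj], [Phi_min_surj]).

    Finally, [q = p - 2 m] with [p] equal to 0 or 1 forces [m = - floor(q/2)],
    so that exactly one of these preimages of [v] ends at 0 or 1. *)

(** * Extending a walk by one step *)

Lemma is_stepP (s : int) :
  reflect [\/ s = 1, s = 0 | s = -1] (s \in [:: 1; 0; -1]).
Proof. by rewrite !inE; apply: (iffP or3P) => -[] /eqP; constructor. Qed.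

Lemma is_walk_rcons w (s : int) :
  is_walk (rcons w s) = (s \in [:: 1; 0; -1]) && is_walk w.
Proof. exact: all_rcons. Qed.

Lemma pos_rcons w (s : int) k : (k <= size w)%N -> pos (rcons w s) k = pos w k.
Proof.
move=> le_kw; apply: eq_bigr => i _.
by rewrite nth_rcons (leq_trans (ltn_ord i) le_kw).
Qed.

Lemma walk_end_rcons w (s : int) : walk_end (rcons w s) = walk_end w + s.
Proof.
rewrite /walk_end size_rcons {1}/pos big_ord_recr /= nth_rcons ltnn eqxx.
by congr (_ + _); exact: pos_rcons.
Qed.

Lemma walk_end_nil : walk_end [::] = 0.
Proof. exact: big_ord0. Qed.

Lemma visited_nil : visited [::] = [:: 0].
Proof. by rewrite /visited /= -[pos _ _]/(walk_end [::]) walk_end_nil. Qed.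

Lemma size_visited w : size (visited w) = (size w).+1.
Proof. by rewrite /visited size_map size_iota. Qed.

Lemma walk_end_visited w : walk_end w \in visited w.
Proof. by apply: (map_f (pos w)); rewrite mem_iota leqnn. Qed.

Lemma visited_rcons w (s : int) :
  visited (rcons w s) = rcons (visited w) (walk_end w + s).
Proof.
rewrite -walk_end_rcons /visited -!/(mkseq _ _) mkseqS /walk_end.
congr rcons; rewrite size_rcons.
by apply/eq_in_map => k; rewrite mem_iota => /andP[_ ?]; exact: pos_rcons.
Qed.

Lemma min_visited_nil : min_visited [::] = 0.
Proof. by rewrite /min_visited visited_nil big_cons big_nil. Qed.

Lemma min_visited_rcons w (s : int) :
  min_visited (rcons w s) = Num.min (min_visited w) (walk_end w + s).
Proof.
rewrite /min_visited visited_rcons big_rcons_op /=.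
elim: (visited w) => [|x r IHr]; first by rewrite !big_nil; lia.
by rewrite !big_cons IHr; lia.
Qed.

Lemma min_visited_lb w (x : int) : x \in visited w -> min_visited w <= x.
Proof.
rewrite /min_visited; elim: (visited w) => //= y r IHr.
by rewrite inE big_cons => /orP[/eqP->|/IHr]; lia.
Qed.

Lemma min_visited_le w : min_visited w <= 0 /\ min_visited w <= walk_end w.
Proof.
elim/last_ind: w => [|w s [? ?]]; first by rewrite min_visited_nil walk_end_nil.
by rewrite min_visited_rcons walk_end_rcons; lia.
Qed.

(** A walk moves by at most 1, so a step that goes below the running minimum
    starts at this minimum and lowers it by exactly 1. *)
Lemma step_to_new_min w (s : int) :
  s \in [:: 1; 0; -1] -> walk_end w + s < min_visited w ->
  s = -1 /\ walk_end w = min_visited w.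
Proof. by case: (min_visited_le w) => ? ? /is_stepP[] ->; lia. Qed.

Lemma visited_above_min w (x : int) :
  is_walk w -> min_visited w <= x <= 0 -> x \in visited w.
Proof.
elim/last_ind: w => [|w s IHw] /=.
  by rewrite min_visited_nil visited_nil inE; lia.
rewrite is_walk_rcons => /andP[step_s walk_w] x_bd.
rewrite visited_rcons mem_rcons inE.
have [le_mx | lt_xm] := leP (min_visited w) x; first by rewrite IHw ?orbT //; lia.
move: x_bd; rewrite min_visited_rcons => x_bd.
have [|s_eq end_w] := step_to_new_min w s step_s; first by lia.
by apply/orP; left; apply/eqP; lia.
Qed.

(** * The reversed steps *)

Lemma first_reach_rcons w (s : int) j : - j%:Z \in visited w ->
  first_reach (rcons w s) j = first_reach w j.
Proof. by rewrite /first_reach visited_rcons -cats1 index_cat => ->. Qed.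

Lemma visited_reversed w j : is_walk w ->
  j \in iota 1 `|min_visited w|%N -> - j%:Z \in visited w.
Proof.
move=> walk_w; rewrite mem_iota => j_bd; apply: visited_above_min => //.
by case: (min_visited_le w) => *; lia.
Qed.

Lemma reversed_steps_le w k :
  is_walk w -> k \in reversed_steps w -> (k <= size w)%N.
Proof.
move=> walk_w /mapP[j /(visited_reversed _ _ walk_w) vis_j ->].
by rewrite -ltnS -size_visited index_mem.
Qed.

Lemma reversed_steps_rcons w (s : int) : is_walk w -> s \in [:: 1; 0; -1] ->
  reversed_steps (rcons w s) =
    if walk_end w + s < min_visited w
    then rcons (reversed_steps w) (size w).+1 else reversed_steps w.
Proof.
move=> walk_w step_s; have [m_le0 m_le] := min_visited_le w.
have old_steps : [seq first_reach (rcons w s) j | j <- iota 1 `|min_visited w|]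
                 = reversed_steps w.
  by apply/eq_in_map => j /(visited_reversed _ _ walk_w); exact: first_reach_rcons.
rewrite {1}/reversed_steps min_visited_rcons; case: ifPn => [drop|no_drop]; last first.
  by rewrite -old_steps; congr (map _ (iota _ _)); lia.
have [s_eq end_w] := step_to_new_min w s step_s drop.
have -> : absz (Num.min (min_visited w) (walk_end w + s)) = (`|min_visited w| + 1)%N.
  by lia.
rewrite iotaD map_cat old_steps cats1 /=; congr rcons.
(* The walk had not reached this level before its last step: all the earlier
   positions are at least min_visited w. *)
have -> : first_reach (rcons w s) (1 + `|min_visited w|) = size (visited w).
  rewrite /first_reach visited_rcons -cats1 index_cat.
  have -> : - (1 + `|min_visited w|)%N%:Z = walk_end w + s by lia.
  case: ifPn => [vis|_]; last by rewrite /= eqxx addn0.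
  by have := min_visited_lb _ _ vis; lia.
by rewrite size_visited.
Qed.

(** The recursion that the whole proof rests on: the image of the last step
    depends only on the position and on the minimum before this step. *)
Lemma Phi_rcons w (s : int) : is_walk w -> s \in [:: 1; 0; -1] ->
  Phi (rcons w s) =
    rcons (Phi w) (if walk_end w + s < min_visited w then 1 else s).
Proof.
move=> walk_w step_s; rewrite /Phi size_rcons mkseqS.
have notin_w : ((size w).+1 \in reversed_steps w) = false.
  by apply/negP => /(reversed_steps_le _ _ walk_w); rewrite ltnn.
rewrite reversed_steps_rcons //; congr rcons.
  apply/eq_in_map => i; rewrite mem_iota => /andP[_ lt_iw].
  rewrite nth_rcons lt_iw; congr (if _ then _ else _); case: ifP => // _.
  by rewrite mem_rcons inE eqSS ltn_eqF.
rewrite nth_rcons ltnn eqxx.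
by case: (_ < _)%R; rewrite ?mem_rcons ?inE ?eqxx ?notin_w.
Qed.

Lemma size_Phi w : size (Phi w) = size w.
Proof. exact: size_mkseq. Qed.

Lemma Phi_nil : Phi [::] = [::].
Proof. by []. Qed.

Lemma count0_Phi w :
  is_walk w -> count_mem (0 : int) (Phi w) = count_mem (0 : int) w.
Proof.
elim/last_ind: w => // w s IHw; rewrite is_walk_rcons => /andP[step_s walk_w].
rewrite Phi_rcons // -!cats1 !count_cat IHw //; congr (_ + _)%N.
by case: ifP => // /(step_to_new_min _ _ step_s)[-> _].
Qed.

(** Reversing a step of the walk raises the end of the image by 2, and this
    occurs once for each new minimum. *)
Lemma walk_end_Phi w :
  is_walk w -> walk_end (Phi w) = walk_end w - 2 * min_visited w.
Proof.
elim/last_ind: w => [|w s IHw].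
  by rewrite Phi_nil walk_end_nil min_visited_nil.
rewrite is_walk_rcons => /andP[step_s walk_w].
rewrite Phi_rcons // !walk_end_rcons min_visited_rcons IHw //.
by case: ifP => [/(step_to_new_min _ _ step_s)[-> ?]|?]; lia.
Qed.

Lemma Phi_nonnegative w : is_walk w -> nonnegative_walks (Phi w).
Proof.
elim/last_ind: w => [|w s IHw].
  by split=> // x; rewrite Phi_nil visited_nil inE => /eqP->.
move=> walk_ws; have := walk_ws; rewrite is_walk_rcons => /andP[step_s walk_w].
have [walk_Pw Pw_ge0] := IHw walk_w; have := walk_end_Phi _ walk_ws.
rewrite /nonnegative_walks /= Phi_rcons // is_walk_rcons walk_end_rcons => end_P.
split; first by rewrite walk_Pw andbT; case: ifP.
move=> x; rewrite visited_rcons mem_rcons inE => /orP[/eqP->|/Pw_ge0 //].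
by have [? ?] := min_visited_le (rcons w s); rewrite end_P; lia.
Qed.

(** * Decoding from right to left *)

(** Equal images and equal minima give equal ends, by [walk_end_Phi]; comparing
    the common end with the common minimum then tells, for both walks alike,
    whether a last step [+1] of the image comes from a reversed step. *)
Lemma Phi_min_inj w1 w2 : is_walk w1 -> is_walk w2 ->
  Phi w1 = Phi w2 -> min_visited w1 = min_visited w2 -> w1 = w2.
Proof.
elim/last_ind: w1 w2 => [|w1 s1 IHw] w2 walk1 walk2 eqP eqm.
  by apply/esym/size0nil; rewrite -size_Phi -eqP.
case/lastP: w2 walk2 eqP eqm => [_ /(congr1 size)|w2 s2 walk2 eqP eqm].
  by rewrite !size_Phi size_rcons.
have eqe : walk_end (rcons w1 s1) = walk_end (rcons w2 s2).
  by have := walk_end_Phi _ walk1; rewrite eqP eqm walk_end_Phi //; lia.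
move: walk1 walk2 eqP eqm eqe; rewrite !is_walk_rcons.
move=> /andP[step1 walk1] /andP[step2 walk2].
rewrite !Phi_rcons // !min_visited_rcons !walk_end_rcons.
move=> /rcons_inj[eqP eqs] eqm eqe.
have [? ?] := min_visited_le w1; have [? ?] := min_visited_le w2.
have [eqs12 eqm12] : s1 = s2 /\ min_visited w1 = min_visited w2.
  case: ifP eqs => [/(step_to_new_min _ _ step1)[? ?]|?];
  by case: ifP => [/(step_to_new_min _ _ step2)[? ?]|?]; lia.
by rewrite eqs12 (IHw w2).
Qed.

Lemma nonnegative_rcons v t : nonnegative_walks (rcons v t) ->
  [/\ nonnegative_walks v, t \in [:: 1; 0; -1] & 0 <= walk_end v + t].
Proof.
case; rewrite is_walk_rcons visited_rcons => /andP[step_t walk_v] ge0.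
split=> //; last by rewrite ge0 // mem_rcons mem_head.
by split=> // x vis_x; rewrite ge0 // mem_rcons inE vis_x orbT.
Qed.

(** The bound [- walk_end v <= m] says that the walk to be found, whose end is
    [walk_end v + 2 m], ends at or above its minimum.  Undoing the last step
    keeps both bounds: a reversed step is undone when [walk_end v = - m] and
    the last step of [v] is [+1], so that [walk_end v > 0] and the negative [m]
    can be raised by 1. *)
Lemma Phi_min_surj v (m : int) :
  nonnegative_walks v -> - walk_end v <= m <= 0 ->
  exists w, [/\ is_walk w, Phi w = v & min_visited w = m].
Proof.
elim/last_ind: v m => [|v t IHv] m.
  rewrite walk_end_nil => _ m_bd; exists [::]; split=> //.
  by rewrite min_visited_nil; lia.
move=> /nonnegative_rcons[nneg_v step_t end_ge0]; rewrite walk_end_rcons => m_bd.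
(* The walk to be found ends at walk_end v + t + 2 m, by walk_end_Phi. *)
have [/andP[/eqP t_eq1 /eqP at_min]|copied] :=
  boolP ((t == 1) && (walk_end v + t + 2 * m == m)).
- have v_ge0 : 0 <= walk_end v.
    by case: nneg_v => _; apply; exact: walk_end_visited.
  have [|w [walk_w Pw m_w]] := IHv (m + 1) nneg_v; first by lia.
  have end_w := walk_end_Phi _ walk_w; rewrite Pw in end_w.
  exists (rcons w (-1)); rewrite is_walk_rcons walk_w Phi_rcons // Pw.
  rewrite min_visited_rcons; split=> //; last by lia.
  by rewrite ifT ?t_eq1 //; lia.
have [|w [walk_w Pw m_w]] := IHv m nneg_v.
  by move: copied; case/is_stepP: step_t m_bd end_ge0 => ->; lia.
have end_w := walk_end_Phi _ walk_w; rewrite Pw in end_w.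
exists (rcons w t); rewrite is_walk_rcons step_t walk_w Phi_rcons // Pw.
rewrite min_visited_rcons; split=> //; last by lia.
by rewrite ifF //; lia.
Qed.

(** * The bijection *)

Theorem theorem1 :
  set_bij walks_to_0_or_1 nonnegative_walks Phi
  /\ (forall w : seq int, walks_to_0_or_1 w ->
        size (Phi w) = size w /\ count_mem (0 : int) (Phi w) = count_mem (0 : int) w)
  /\ (forall (w : seq int) (d e : nat),
        is_walk w -> (e = 0%N \/ e = 1%N) ->
        walk_end w = e%:Z -> min_visited w = - d%:Z ->
        walk_end (Phi w) = (2 * d + e)%N%:Z).
Proof.
split; last split.
- split.
  + by move=> w [walk_w _]; exact: Phi_nonnegative.
  + move=> w1 w2; rewrite !inE => -[walk1 end1] [walk2 end2] eqP.
    apply: Phi_min_inj => //.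
    have := walk_end_Phi _ walk1; rewrite eqP walk_end_Phi //.
    (* The ends differ by an even number and lie in {0, 1}. *)
    by lia.
  + move=> v nneg_v.
    have v_ge0 : 0 <= walk_end v.
      by case: nneg_v => _; apply; exact: walk_end_visited.
    have [|w [walk_w Pw m_w]] := Phi_min_surj v (- (`|walk_end v| %/ 2)%N%:Z) nneg_v.
      by lia.
    exists w => //; split=> //.
    by have := walk_end_Phi _ walk_w; rewrite Pw m_w; lia.
- by move=> w [walk_w _]; rewrite size_Phi count0_Phi.
- move=> w d e walk_w _ end_w min_w.
  by rewrite walk_end_Phi // end_w min_w; lia.
Qed.
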